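(* Let $p$ be prime, $a\in\mathbb{Z}_p^\times$, and $k$ an integer with $2\le k\le p-2$ and $\gcd(k,p-1)=1$. Then $D(\eta_{a,k})\le C\,k^{1/4}p^{3/4}\log^2 p$ for an absolute constant $C$ (uniformly in $a$ and $k$).
   Context: $\eta_{a,k}$ is the permutation of $\mathbb{Z}_p$ given by $\eta_{a,k}(s)=as^k$ (a permutation since $\gcd(k,p-1)=1$). An interval of $\mathbb{Z}_n$ is any subset that is the image of an interval of consecutive integers under the projection $\mathbb{Z}\to\mathbb{Z}_n$ (wrap-around allowed). For $S,T\subseteq\mathbb{Z}_n$, $D_T(S)=\bigl|\,|S\cap T|-|S||T|/n\,\bigr|$, and for a permutation $\sigma$ of $\mathbb{Z}_n$, $D(\sigma)=\max_{I,J}D_J(\sigma(I))$ over all intervals $I,J$ of $\mathbb{Z}_n$. *)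

(* Defs.v *)
From Stdlib Require Import Reals.
From mathcomp Require Import all_boot.

Set Implicit Arguments.
Unset Strict Implicit.
Unset Printing Implicit Defensive.

(* Intervals of Z_n (Z_n represented by 'I_n): images of {m, m+1, ..., m+l-1}
   under Z -> Z_n.  Since the image only depends on m mod n, and any l >= n gives
   the whole of Z_n (same as l = n), it suffices to take m < n and l <= n. *)
Definition interval_set (n : nat) (m l : nat) : {set 'I_n} :=
  [set i : 'I_n | [exists j : 'I_l, val i == (m + j) %% n]].

Definition is_interval (n : nat) (S : {set 'I_n}) : bool :=
  [exists m : 'I_n, exists l : 'I_n.+1, S == interval_set n m l].

Definition discT (n : nat) (T S : {set 'I_n}) : R :=
  Rabs (INR #|S :&: T| - INR #|S| * INR #|T| / INR n).

(* D(sigma) = max over intervals I, J of D_J(sigma(I)) (all values are >= 0,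
   so 0 is a neutral element for Rmax here). *)
Definition Dperm (n : nat) (sigma : 'I_n -> 'I_n) : R :=
  \big[Rmax/R0]_(I | @is_interval n I)
    \big[Rmax/R0]_(J | @is_interval n J) discT J (sigma @: I).

(* eta_{a,k}(s) = a s^k in Z_n (the default argument of insubd is never used
   since (a * s^k) %% n < n whenever 'I_n is inhabited). *)
Definition eta (n a k : nat) (s : 'I_n) : 'I_n := insubd s ((a * s ^ k) %% n).
Arguments eta n a k s : clear implicits.

(* Main.v *)
(* Let psi be a nontrivial additive character of F_p and
   S(u, v) = sum_x psi(u x + v x^k).  Substituting x -> t x gives
   S(u, v) = S(u t, v t^k), so for u != 0 the value |S(u, v)|^4 occurs at least
   p - 1 times in the fourth moment of S, which is p^2 times the number of
   solutions of x1 + x2 = x3 + x4, x1^k + x2^k = x3^k + x4^k.  Setting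
   h = x1 - x3 = x4 - x2, a solution with h != 0 has x2 among the roots of a
   nonzero polynomial of degree < k determined by h and x3, so there are at most
   k p^2 solutions and |S(u, v)|^4 <= 2 k p^3.  Since x -> a x^k is a
   permutation, S(u, 0) and S(0, v) vanish for u, v != 0, and Fourier inversion
   bounds the discrepancy by p^-2 max |S| times the product of the L1 norms of
   the Fourier transforms of the two intervals off 0, each O(p log p). *)

Require Import Defs.
From Stdlib Require Import Reals Lra.
From mathcomp Require Import all_boot all_order all_algebra all_field.
From mathcomp Require Import complex Rstruct zify.

Set Implicit Arguments.
Unset Strict Implicit.
Unset Printing Implicit Defensive.

Import Order.TTheory GRing.Theory Num.Theory.

Delimit Scope R_scope with Re.
Local Open Scope ring_scope.

(** * Exponential sums over a finite field *)

Section AdditiveCharacter.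

Variables (F : finFieldType) (C : numClosedFieldType) (psi : F -> C).
Hypothesis psi0 : psi 0 = 1.
Hypothesis psiD : {morph psi : x y / x + y >-> x * y}.
Hypothesis psiJ : forall x, (psi x)^* = psi (- x).
Hypothesis psi_nontriv : exists x, psi x != 1.

(** For [a != 0], translating [x] by [y / a] multiplies the sum by [psi y]; choosing [psi y != 1]
    forces it to vanish. *)
Lemma sum_character a : \sum_x psi (a * x) = #|F|%:R *+ (a == 0).
Proof.
have [-> | nz_a] := eqVneq a 0.
  by under eq_bigr do rewrite mul0r psi0; rewrite sumr_const.
have [y psi_y] := psi_nontriv; rewrite mulr0n.
set S := \sum_x _; have /eqP: S = S * psi y.
  rewrite {1}/S (reindex_inj (addIr (y / a))) mulr_suml /=.
  by apply: eq_bigr => x _; rewrite mulrDr psiD [a * (_ / _)]mulrC divfK.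
rewrite -subr_eq0 -{1}[S]mulr1 -mulrBr mulf_eq0 subr_eq0 [1 == _]eq_sym.
by rewrite (negPf psi_y) orbF => /eqP.
Qed.

Definition dft (g : F -> C) (v : F) : C := \sum_z g z * psi (v * z).

Definition expsum (h : F -> F) (u v : F) : C := \sum_x psi (u * x + v * h x).

Lemma dft_inversion g y : \sum_v dft g v * psi (- v * y) = #|F|%:R * g y.
Proof.
under eq_bigr do rewrite mulr_suml; rewrite exchange_big /=.
transitivity (\sum_z g z * (#|F|%:R *+ (z - y == 0))).
  apply: eq_bigr => z _; rewrite -sum_character mulr_sumr.
  by apply: eq_bigr => v _; rewrite -mulrA -psiD mulNr -mulrBr [v * _]mulrC.
rewrite (bigD1 y) //= subrr eqxx mulrC big1 ?addr0 // => z z_y.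
by rewrite subr_eq0 (negPf z_y) mulr0n mulr0.
Qed.

Lemma dft_correlation f g h :
  #|F|%:R ^+ 2 * \sum_x f x * g (h x) =
  \sum_u \sum_v dft f u * dft g v * expsum h (- u) (- v).
Proof.
transitivity (\sum_x (\sum_u dft f u * psi (- u * x)) *
                     (\sum_v dft g v * psi (- v * h x))).
  rewrite mulr_sumr; apply: eq_bigr => x _.
  by rewrite !dft_inversion expr2 mulrACA.
under eq_bigr do rewrite big_distrlr /=.
rewrite exchange_big; apply: eq_bigr => u _.
rewrite exchange_big; apply: eq_bigr => v _.
by rewrite mulr_sumr; apply: eq_bigr => x _; rewrite psiD mulrACA.
Qed.

Lemma expsum00 h : expsum h 0 0 = #|F|%:R.
Proof.
by rewrite /expsum; under eq_bigr do rewrite !mul0r addr0 psi0; rewrite sumr_const.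
Qed.

Lemma expsum_u0 h u : u != 0 -> expsum h u 0 = 0.
Proof.
move=> nz_u; rewrite /expsum; under eq_bigr do rewrite mul0r addr0.
by rewrite sum_character (negPf nz_u).
Qed.

Lemma expsum_0v h v : injective h -> v != 0 -> expsum h 0 v = 0.
Proof.
move=> inj_h nz_v; rewrite /expsum; under eq_bigr do rewrite mul0r add0r.
rewrite -(reindex_inj inj_h (P := xpredT) (F := fun x => psi (v * x))).
by rewrite sum_character (negPf nz_v).
Qed.

(** In the Fourier expansion of the correlation, the frequency (0, 0) gives exactly the expected
    main term, and the other frequencies on the axes vanish because [h] is a permutation. Only pairs
    with both frequencies nonzero remain. *)
Lemma discrepancy_le_expsum f g h B :
  injective h -> (forall u v, u != 0 -> `|expsum h u v| <= B) ->
  `|#|F|%:R ^+ 2 * (\sum_x f x * g (h x)) - #|F|%:R * (\sum_x f x) * (\sum_x g x)|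
    <= (\sum_(u | u != 0) `|dft f u|) * (\sum_(v | v != 0) `|dft g v|) * B.
Proof.
move=> inj_h leB; rewrite dft_correlation.
have dft0 e : dft e 0 = \sum_x e x.
  by apply: eq_bigr => x _; rewrite mul0r psi0 mulr1.
rewrite (bigD1 0) //= (bigD1 0) //= big1 ?addr0; last first.
  by move=> v nz_v; rewrite oppr0 expsum_0v ?oppr_eq0 // mulr0.
rewrite oppr0 expsum00 !dft0  [_ * _ * #|F|%:R]mulrC mulrA addrAC subrr add0r.
rewrite big_distrlr mulr_suml (le_trans (ler_norm_sum _ _ _)) //.
apply: ler_sum => u nz_u; rewrite (bigD1 0) //= oppr0 expsum_u0 ?oppr_eq0 //.
rewrite mulr0 add0r mulr_suml (le_trans (ler_norm_sum _ _ _)) //.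
apply: ler_sum => v nz_v; rewrite !normrM ler_wpM2l ?mulr_ge0 //.
by rewrite leB ?oppr_eq0.
Qed.

(** * Moments of exponential sums *)

(** Expanding the square and applying orthogonality in [u] and in [v] leaves only coincidences. The
    index type is arbitrary so that [T := F * F] yields the fourth moment. *)
Lemma second_moment (T : finType) (a b : T -> F) :
  \sum_u \sum_v `|\sum_t psi (u * a t + v * b t)| ^+ 2 =
  #|F|%:R ^+ 2 * #|[set t : T * T | (a t.1 == a t.2) && (b t.1 == b t.2)]|%:R.
Proof.
transitivity (\sum_u \sum_v \sum_t \sum_t'
    psi (u * (a t - a t')) * psi (v * (b t - b t'))).
  apply: eq_bigr => u _; apply: eq_bigr => v _.
  rewrite normCK rmorph_sum big_distrlr /=; apply: eq_bigr => t _.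
  apply: eq_bigr => t' _; rewrite psiJ -!psiD; congr psi.
  by rewrite !mulrBr opprD addrACA.
transitivity (\sum_t \sum_t' #|F|%:R ^+ 2 *+ ((a t == a t') && (b t == b t')) : C).
  under eq_bigr do rewrite exchange_big /=.
  rewrite exchange_big /=; apply: eq_bigr => t _.
  under eq_bigr do rewrite exchange_big /=.
  rewrite exchange_big /=; apply: eq_bigr => t' _.
  under eq_bigr do rewrite -mulr_sumr; rewrite -mulr_suml.
  under eq_bigr do rewrite mulrC; under [X in _ * X]eq_bigr do rewrite mulrC.
  by rewrite !sum_character !subr_eq0 mulrnAl mulrnAr -mulrnA mulnb andbC.
rewrite pair_big /= mulr_natr; move: (_ ^+ 2) => q.
rewrite -sumr_const [in RHS]big_mkcond /=.
apply: eq_bigr => -[t t'] _; rewrite inE /=.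
by case: ifP.
Qed.

Lemma fourth_moment_pow k :
  \sum_u \sum_v `|expsum (fun x => x ^+ k) u v| ^+ 4 =
  #|F|%:R ^+ 2 * #|[set t : (F * F) * (F * F) |
      (t.1.1 + t.1.2 == t.2.1 + t.2.2) &&
      (t.1.1 ^+ k + t.1.2 ^+ k == t.2.1 ^+ k + t.2.2 ^+ k)]|%:R.
Proof.
rewrite -(second_moment (fun t => t.1 + t.2) (fun t => t.1 ^+ k + t.2 ^+ k)).
apply: eq_bigr => u _; apply: eq_bigr => v _.
rewrite (exprM _ 2 2) -normrX [expsum _ _ _ ^+ 2]expr2 big_distrlr pair_big /=.
congr (`|_| ^+ 2); apply: eq_bigr => t _; rewrite -psiD; congr psi.
by rewrite !mulrDr addrACA.
Qed.

(* The substitution x -> t x shows that expsum takes the same value on the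
   whole orbit (u t, v t^k), which has #|F| - 1 points when u != 0. *)
Lemma expsum_pow_orbit k u v : u != 0 ->
  (#|F|.-1)%:R * `|expsum (fun x => x ^+ k) u v| ^+ 4 <=
  \sum_u' \sum_v' `|expsum (fun x => x ^+ k) u' v'| ^+ 4.
Proof.
move=> nz_u; rewrite (bigD1 0) //= -[leLHS]add0r lerD ?sumr_ge0 //.
  by move=> v' _; rewrite exprn_ge0.
rewrite (reindex_inj (mulfI nz_u)) /=.
rewrite (eq_bigl (fun t => t != 0)); last by move=> t; rewrite mulf_eq0 negb_or nz_u.
rewrite -(cardC1 (0 : F)) mulr_natl -sumr_const /=.
(* In the row [u * t], only the orbit point is kept; the other terms are nonnegative. *)
apply: ler_sum => t nz_t; rewrite (bigD1 (v * t ^+ k)) //=.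
suff -> : expsum (fun x => x ^+ k) (u * t) (v * t ^+ k) =
          expsum (fun x => x ^+ k) u v.
  by rewrite lerDl sumr_ge0 // => v' _; rewrite exprn_ge0.
rewrite /expsum [RHS](reindex_inj (mulfI nz_t)) /=.
by apply: eq_bigr => x _; rewrite exprMn !mulrA.
Qed.

End AdditiveCharacter.

(** * Counting solutions of the power equations *)

(** As a polynomial in [y], the difference has degree [k - 1] and leading coefficient [k * h]. As
    [k - 1 > 0], subtracting [c] does not touch that coefficient. *)
Lemma card_pow_shift_eq (F : finFieldType) k (h c : F) :
  (1 < k)%N -> k%:R != 0 :> F -> h != 0 ->
  (#|[set y : F | ((h + y) ^+ k - y ^+ k == c)%R]| <= k.-1)%N.
Proof.
move=> k_gt1 nz_k nz_h; set A := [set y | _].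
pose Q := \poly_(i < k) (h ^+ (k - i) *+ 'C(k, i)).
have hornerQ y : Q.[y] = (h + y) ^+ k - y ^+ k.
  rewrite exprDn big_ord_recr /= subnn mul1r binn addrK horner_poly.
  by apply: eq_bigr => i _; rewrite mulrnAl.
have nzP : Q - c%:P != 0.
  apply/eqP => /(congr1 (fun P : {poly F} => P`_k.-1)) /eqP.
  case: k k_gt1 nz_k @Q {A hornerQ} => [|[|k]] //= _ nz_k.
  rewrite coefB coefC coef0 coef_poly ltnSn subr0 subSnn binSn -mulr_natr.
  by rewrite mulf_eq0 (negPf nz_h) (negPf nz_k).
rewrite cardE -ltnS prednK ?(ltnW k_gt1) //.
have: (size (enum A) < size (Q - c%:P)%R)%N.
  apply: max_poly_roots; rewrite ?enum_uniq //; apply/allP => y.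
  by rewrite mem_enum inE rootE hornerD hornerN hornerC hornerQ subr_eq0.
move/leq_trans; apply; rewrite (leq_trans (size_polyD _ _)) // size_polyN geq_max.
by rewrite size_poly (leq_trans (size_polyC_leq1 _)) // ltnW.
Qed.

Lemma card_equal_sums_pow (F : finFieldType) k : (1 < k)%N -> k%:R != 0 :> F ->
  (#|[set t : (F * F) * (F * F) |
      (t.1.1 + t.1.2 == t.2.1 + t.2.2)%R &&
      (t.1.1 ^+ k + t.1.2 ^+ k == t.2.1 ^+ k + t.2.2 ^+ k)%R]| <= k * #|F| ^ 2)%N.
Proof.
move=> k_gt1 nz_k; set A := [set t | _].
(* Here [x] is x3, [h] is x1 - x3 = x4 - x2 and [y] is x2; these three determine the solution. *)
pose B x h := [set y : F | (h + y) ^+ k - y ^+ k == (h + x) ^+ k - x ^+ k].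
pose A' := [set s : F * F * F | s.2 \in B s.1.1 s.1.2].
have: (#|A| <= #|A'|)%N.
  pose f (t : (F * F) * (F * F)) := ((t.2.1, t.1.1 - t.2.1), t.1.2).
  have /card_in_imset <- : {in A &, injective f}.
    move=> [[x1 x2] [x3 x4]] [[y1 y2] [y3 y4]] /[!inE] /=.
    move=> /andP[/eqP eqx _] /andP[/eqP eqy _] [e3 + e2]; subst.
    move=> /addIr e1; subst; congr (_, (_, _)).
    by apply: (addrI y3); rewrite -eqx -eqy.
  apply/subset_leq_card/subsetP => s /imsetP[[[x1 x2] [x3 x4]]].
  rewrite !inE /= => /andP[/eqP eqS /eqP eqK] -> /=.
  rewrite subrK addrAC eqS addrAC subrr add0r subr_eq addrAC eqK.
  by rewrite addrAC subrr add0r.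
move/leq_trans; apply; rewrite -sum1_card.
rewrite (eq_bigl (fun s => true && (s.2 \in B s.1.1 s.1.2))); last first.
  by move=> s; rewrite inE.
rewrite -(pair_big_dep predT (fun s y => y \in B s.1 s.2) (fun _ _ => 1%N)) /=.
rewrite (eq_bigr (fun s => #|B s.1 s.2|)); last by move=> s _; rewrite sum1_card.
rewrite -(pair_big predT predT (fun x h => #|B x h|)) /=.
have le_x x : (\sum_h #|B x h| <= k * #|F|)%N.
  (* With q the order of [F], the value [h = 0] allows all q choices of [y], every other [h] at most
     [k - 1]: in total q + (q - 1)(k - 1) <= k q. *)
  rewrite (bigD1 0) //=.
  have le_h : (\sum_(h | h != 0%R) #|B x h| <= \sum_(h : F | h != 0%R) k.-1)%N.
    by apply: leq_sum => h nz_h; apply: card_pow_shift_eq.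
  apply: leq_trans (leq_add (max_card _) le_h) _.
  rewrite sum_nat_const (cardC1 (0 : F)).
  rewrite -[X in (_ <= X * _)%N](ltn_predK k_gt1) mulSn leq_add2l.
  by rewrite mulnC leq_mul2l leq_pred orbT.
apply: (@leq_trans (\sum_(x : F) k * #|F|)).
  by apply: leq_sum => x _; apply: le_x.
by rewrite sum_nat_const mulnCA.
Qed.

Lemma expsum_pow_le (F : finFieldType) (C : numClosedFieldType) (psi : F -> C)
    k u v :
  psi 0 = 1 -> {morph psi : x y / x + y >-> x * y} ->
  (forall x, (psi x)^* = psi (- x)) -> (exists x, psi x != 1) ->
  (1 < k)%N -> k%:R != 0 :> F -> u != 0 ->
  `|expsum psi (fun x => x ^+ k) u v| ^+ 4 <= 2 * k%:R * #|F|%:R ^+ 3.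
Proof.
move=> psi0 psiD psiJ psi_nt k_gt1 nz_k nz_u.
have q_gt1 : (1 < #|F|)%N by apply: finRing_gt1.
have q1_gt0 : 0 < (#|F|.-1)%:R :> C by rewrite ltr0n; lia.
rewrite -(ler_pM2l q1_gt0) (le_trans (expsum_pow_orbit psi k v nz_u)) //.
rewrite fourth_moment_pow //.
apply: (@le_trans _ _ (#|F|%:R ^+ 2 * (k * #|F| ^ 2)%:R)).
  by rewrite ler_wpM2l ?exprn_ge0 // ler_nat card_equal_sums_pow.
(* The factor 2 comes from q <= 2 (q - 1), where q is the order of [F]. *)
rewrite -!natrX -!natrM ler_nat; nia.
Qed.

(** * Real estimates *)

Local Close Scope ring_scope.
Local Open Scope R_scope.

Lemma inv_succ_le_ln n : (0 < n)%N -> / INR n.+1 <= ln (INR n.+1) - ln (INR n).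
Proof.
move=> n_gt0; have n0 : 0 < INR n by apply: lt_0_INR; apply/ssrnat.ltP.
(* Logarithms are taken in 1 + t <= exp t at t = -1/(n+1), where 1 + t = n/(n+1). *)
have := exp_ineq1_le (- / INR n.+1); rewrite S_INR.
have -> : 1 + - / (INR n + 1) = INR n / (INR n + 1) by field; lra.
have q0 : 0 < INR n / (INR n + 1) by apply: Rdiv_lt_0_compat; lra.
case=> [/(ln_increasing _ _ q0) | /(congr1 ln)]; 
  rewrite ln_exp /Rdiv ln_mult ?ln_Rinv; try lra; apply: Rinv_0_lt_compat; lra.
Qed.

Lemma sum_inv_le_ln n :
  (\sum_(i < n.+1) i.+1%:R^-1 <= 1 + ln n.+1%:R)%R.
Proof.
apply/RleP; elim: n => [|n IHn].
  by rewrite big_ord1 invr1 ln_1 addr0; apply: Rle_refl.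
rewrite big_ord_recr /=; apply: Rle_trans (Rplus_le_compat_r _ _ _ IHn) _.
by have := @inv_succ_le_ln n.+1 isT; rewrite -!INRE -!RplusE -RinvE -[1%R]/1; lra.
Qed.

(** On [0, 1/2] even [y <= sin (PI * y)] holds; the other half follows by the reflection
    [x -> 1 - x]. *)
Lemma sin_PI_ge x : 0 <= x <= 1 -> x * (1 - x) <= sin (PI * x).
Proof.
have PI3 := PI2_3_2; have PI4 := PI_4.
have half y : 0 <= y <= 1 / 2 -> y <= sin (PI * y).
  move=> y_bd.
  have [|| le_sin _] := sin_bound (PI * y) 0; try nra.
  apply: Rle_trans le_sin.
  (* The cubic Taylor bound t (1 - t^2/6) with t = PI y: from 3y <= t <= 2 the bracket is at least
     1/3, so the product is at least y. *)
  have -> : sin_approx (PI * y) ((2 * 0)%coq_nat + 1)%coq_nat =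
            PI * y * (1 - (PI * y) * (PI * y) / 6).
    by rewrite /sin_approx /sin_term /=; field.
  have a_bd : 3 * y <= PI * y <= 2 by nra.
  have a2_bd : (PI * y) * (PI * y) <= 4 by nra.
  nra.
move=> x_bd; have [le_x | ge_x] := Rle_lt_dec x (1 / 2).
  by have le_sin := half x ltac:(lra); have := Rle_0_sqr x; rewrite /Rsqr; nra.
have := half (1 - x) ltac:(lra).
have -> : PI * (1 - x) = PI - PI * x by ring.
rewrite sin_PI_x => le_sin; have := Rle_0_sqr (1 - x); rewrite /Rsqr; nra.
Qed.

Local Close Scope R_scope.
Local Open Scope ring_scope.

(** * The character of F_p given by a root of unity *)

Definition unit_root (p : nat) : R[i] :=
  (cos (2 * PI / INR p) +i* sin (2 * PI / INR p))%C.

Lemma unit_rootX p n :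
  unit_root p ^+ n =
  (cos (2 * PI / INR p * INR n) +i* sin (2 * PI / INR p * INR n))%C.
Proof.
elim: n => [|n IHn]; first by rewrite expr0 Rmult_0_r cos_0 sin_0.
rewrite exprSr IHn S_INR Rmult_plus_distr_l Rmult_1_r cos_plus sin_plus.
by rewrite /unit_root; simpc; rewrite [X in (_ +i* X)%C]addrC.
Qed.

Lemma unit_root_order p : (0 < p)%N -> unit_root p ^+ p = 1.
Proof.
move=> p_gt0; rewrite unit_rootX.
have p0 : INR p <> 0%Re by apply: not_0_INR; lia.
have -> : (2 * PI / INR p * INR p = 2 * PI)%Re by field.
by rewrite cos_2PI sin_2PI.
Qed.

(** With x = n/p the left side is 2 x (1 - x), and the right side is 2 sin(PI x). The harmonic form
    is chosen because its reciprocal splits into 1/n + 1/(p - n), ready for summation. *)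
Lemma unit_root_gap p n : (0 < n < p)%N ->
  (2 * (n%:R^-1 + (p - n)%:R^-1)^-1 / p%:R)%:C%C <= `|unit_root p ^+ n - 1|.
Proof.
move=> /andP[n_gt0 n_lt_p]; set r := 2 * _ / _.
have n0 : (0 < INR n)%Re by apply: lt_0_INR; apply/ssrnat.ltP.
have np : (INR n < INR p)%Re by apply: lt_INR; apply/ssrnat.ltP.
pose x := (INR n / INR p)%Re.
have xp : (x * INR p = INR n)%Re by rewrite /x; field; lra.
have x_bd : (0 <= x <= 1)%Re by split; nra.
have rE : r = (2 * (x * (1 - x)))%Re.
  rewrite /r natrB 1?ltnW // -!INRE [INR 2]/= -!RinvE -!RmultE -!RplusE.
  rewrite -RoppE /x; refine (_ : _ = _ :> R); field; lra.
have le_sin := sin_PI_ge x_bd.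
have r_ge0 : 0 <= r by apply/RleP; rewrite rE -[0%R]/(0%Re); nra.
(* Squares are compared, using (cos t - 1)^2 + (sin t)^2 = 4 sin(t/2)^2 with t = 2 PI x. *)
rewrite -(@ler_pXn2r _ 2%N) ?nnegrE ?normr_ge0 ?ler0c //.
rewrite -add_Re2_Im2 -rmorphXn lecR unit_rootX /= subr0; apply/RleP.
have -> : (2 * PI / INR p * INR n = 2 * (PI * x))%Re by rewrite /x; field; lra.
have := sin2_cos2 (2 * (PI * x)); rewrite /Rsqr cos_2a_sin rE.
move: (sin (2 * _)) (sin (PI * x)) le_sin => s2 s le_s eq1.
rewrite !expr2 -!RplusE -!RmultE -RoppE -[1%R]/(1%Re).
have : (0 <= x * (1 - x))%Re by nra.
by move: (x * (1 - x))%Re le_s => y; nra.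
Qed.

Section RootCharacter.

Variables (p : nat) (C : numClosedFieldType) (w : C).
Hypotheses (p_pr : prime p) (wp1 : w ^+ p = 1) (w_neq1 : w != 1).

Definition root_character (x : 'F_p) : C := w ^+ x.

Lemma root_character_nat n : root_character n%:R = w ^+ n.
Proof. by rewrite /root_character val_Fp_nat // expr_mod. Qed.

Lemma root_character0 : root_character 0 = 1.
Proof. by rewrite (root_character_nat 0) expr0. Qed.

Lemma root_characterD : {morph root_character : x y / x + y >-> x * y}.
Proof.
move=> x y; rewrite -[in LHS](natr_Zp x) -[in LHS](natr_Zp y) -natrD.
by rewrite root_character_nat exprD.
Qed.

Lemma norm_root_character x : `|root_character x| = 1.
Proof.
rewrite normrX; suff -> : `|w| = 1 by rewrite expr1n.
apply/eqP; rewrite -(@pexpr_eq1 _ _ p) ?normr_ge0 ?prime_gt0 //.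
by rewrite -normrX wp1 normr1.
Qed.

Lemma root_characterJ x : (root_character x)^* = root_character (- x).
Proof.
have nz : root_character x != 0 by rewrite -normr_eq0 norm_root_character oner_eq0.
apply: (mulfI nz); rewrite -normCK norm_root_character -root_characterD.
by rewrite subrr root_character0 expr1n.
Qed.

Lemma root_character_nontriv : exists x, root_character x != 1.
Proof. by exists 1%:R; rewrite root_character_nat expr1. Qed.

(** The transform is a geometric sum of ratio [root_character u], whose numerator has modulus at
    most 2. The bound [l <= p] ensures that the [l] residues are distinct. *)
Lemma dft_interval_le (m l : nat) (u : 'F_p) : (l <= p)%N -> root_character u != 1 ->
  `|dft root_character
      (fun x => (cast_ord (Fp_cast p_pr) x \in interval_set p m l)%:R) u| <=
  2 / `|root_character u - 1|.
Proof.
move=> le_lp psi_u.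
pose f (j : 'I_l) : 'F_p := (m + j)%:R.
have inj_f : injective f.
  move=> i j /(congr1 val); rewrite /f /= !val_Fp_nat // => /eqP.
  rewrite eqn_modDl !modn_small ?(leq_trans (ltn_ord _)) // => /eqP.
  exact: val_inj.
have -> : dft root_character
    (fun x => (cast_ord (Fp_cast p_pr) x \in interval_set p m l)%:R) u =
    \sum_(j < l) root_character (u * f j).
  rewrite -(big_imset (fun x => root_character (u * x)) (in2W inj_f)) /=.
  rewrite [RHS]big_mkcond; apply: eq_bigr => x _.
  suff -> : (cast_ord (Fp_cast p_pr) x \in interval_set p m l) =
            (x \in [set f i | i in 'I_l]).
    by case: ifP; rewrite ?mul1r ?mul0r.
  rewrite inE; apply/existsP/imsetP => [[j /eqP /= xE] | [j _ ->]]; exists j => //.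
    by apply: val_inj; rewrite [RHS](val_Fp_nat p_pr).
  by rewrite [val _](val_Fp_nat p_pr).
have psiM n : root_character (u * n%:R) = root_character u ^+ n.
  by rewrite -[in LHS](natr_Zp u) -natrM root_character_nat exprM.
under eq_bigr do rewrite psiM exprD; rewrite -mulr_sumr normrM.
rewrite normrX norm_root_character expr1n mul1r.
rewrite ler_pdivlMr ?normr_gt0 ?subr_eq0 // mulrC -normrM -subrX1.
rewrite (le_trans (ler_normB _ _)) // normrX norm_root_character expr1n normr1.
by rewrite -natr1.
Qed.

End RootCharacter.

(** * Discrepancy of the power permutation *)

(** For [y != 0], the quotient z = x/y satisfies z^k = 1 and z^(q-1) = 1, with q the order of [F]; a
    Bezout relation then gives z = 1. *)
Lemma expr_inj_coprime (F : finFieldType) k :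
  (0 < k)%N -> coprime k #|F|.-1 -> injective (fun x : F => x ^+ k).
Proof.
move=> k_gt0 cop x y /= eq_xy.
have [y0 | nz_y] := eqVneq y 0.
  by move/eqP: eq_xy; rewrite y0 expr0n (gtn_eqF k_gt0) expf_eq0 k_gt0 => /eqP.
pose z := x / y; have zk : z ^+ k = 1 by rewrite expr_div_n eq_xy divff ?expf_neq0.
have nz_z : z != 0.
  by apply/eqP => z0; move/eqP: zk; rewrite z0 expr0n (gtn_eqF k_gt0) eq_sym oner_eq0.
have zq : z ^+ #|F|.-1 = 1.
  apply: (mulfI nz_z); rewrite mulr1 -exprS prednK ?expf_card //.
  exact: ltnW (finRing_gt1 F).
have [km kn kmE _] := egcdnP #|F|.-1 k_gt0.
have /(divIf nz_y) // : x / y = y / y.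
rewrite divff // -/z -(expr1 z) -(eqP cop).
have : z ^+ (km * k) = 1 by rewrite mulnC exprM zk expr1n.
by rewrite kmE exprD mulnC exprM zq expr1n mul1r.
Qed.

Lemma sum_Fp_neq0 (V : zmodType) p (G : nat -> V) : prime p ->
  \sum_(u : 'F_p | u != 0) G u = \sum_(i < p.-1) G i.+1.
Proof.
move=> p_pr; rewrite big_mkcond big_ord_recl /= add0r.
rewrite -[in RHS](Fp_cast p_pr) /=.
by apply: eq_bigr.
Qed.

Lemma sum_dft_interval_le p (p_pr : prime p) m l :
  (2 < p)%N -> (l <= p)%N ->
  \sum_(u : 'F_p | u != 0) `|dft (root_character (unit_root p))
      (fun x => (cast_ord (Fp_cast p_pr) x \in interval_set p m l)%:R) u| <=
  (4 * p%:R * ln p%:R)%:C%C.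
Proof.
move=> p_gt2 le_lp.
have wp1 := unit_root_order (prime_gt0 p_pr).
(* This is 2 divided by the lower bound of [unit_root_gap]. *)
pose G n : R := p%:R * (n%:R^-1 + (p - n)%:R^-1).
apply: (@le_trans _ _ (\sum_(u : 'F_p | u != 0) (G u)%:C%C)).
  apply: ler_sum => u nz_u.
  have u_bd : (0 < u < p)%N.
    by rewrite lt0n -[X in (_ < X)%N](Fp_cast p_pr) ltn_ord andbT.
  have gap := unit_root_gap u_bd.
  have G_gt0 : 0 < G u.
    case/andP: u_bd => u_gt0 u_ltp.
    by rewrite mulr_gt0 ?addr_gt0 ?invr_gt0 ?ltr0n ?subn_gt0 // prime_gt0.
  have gap_gt0 : 0 < `|root_character (unit_root p) u - 1|.
    apply: lt_le_trans gap; rewrite ltcR -mulrA -invfM [X in X^-1]mulrC.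
    by rewrite mulr_gt0 ?invr_gt0.
  apply: le_trans (dft_interval_le p_pr wp1 m le_lp _) _.
    by rewrite -subr_eq0 -normr_gt0.
  rewrite ler_pdivrMr // -ler_pdivrMl ?ltcR // (le_trans _ gap) //.
  rewrite -(rmorph_nat (real_complex R)) -fmorphV -rmorphM lecR.
  by rewrite /G invfM mulrC mulrA mulrAC.
rewrite (sum_Fp_neq0 (fun n => (G n)%:C%C)) // -rmorph_sum lecR -mulr_sumr.
rewrite -mulrA mulrCA ler_wpM2l // big_split /=.
(* The reflection n -> p - n makes both halves the same harmonic sum. *)
have -> : \sum_(i < p.-1) (p - i.+1)%:R^-1 = \sum_(i < p.-1) i.+1%:R^-1 :> R.
  rewrite (reindex_inj rev_ord_inj) /=; apply: eq_bigr => i _.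
  by have lt_i := ltn_ord i; congr (_%:R^-1); lia.
have := sum_inv_le_ln p.-2; rewrite !prednK; try lia.
(* Since p >= 3 >= e, the 1 in 1 + ln(p - 1) is absorbed, turning 2 p (1 + ln(p - 1)) into at most 4
   p ln p. *)
have ln1 : (1 <= ln (INR p))%Re.
  rewrite -(ln_exp 1); have le3 : (exp 1 <= INR p)%Re.
    apply: Rle_trans exp_le_3 _; rewrite (_ : 3%Re = INR 3); last first.
      by rewrite /=; lra.
    by apply: le_INR; apply/ssrnat.leP.
  case: le3 => [/(ln_increasing _ _ (exp_pos 1)) | ->]; lra.
have ln2 : (ln (INR p.-1) <= ln (INR p))%Re.
  by apply/Rlt_le/ln_increasing; [apply: lt_0_INR | apply: lt_INR]; lia.
move: (\sum_(i < _) _) => s /RleP le_s; apply/RleP.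
move: le_s; rewrite -!INRE -!RplusE -!RmultE -[1%R]/(1%Re) [INR 4]/=.
by lra.
Qed.

Lemma eta_cast p (p_pr : prime p) a k (x : 'F_p) :
  eta p a k (cast_ord (Fp_cast p_pr) x) =
  cast_ord (Fp_cast p_pr) (a%:R * x ^+ k).
Proof.
have -> : a%:R * x ^+ k = (a * x ^ k)%:R by rewrite natrM natrX natr_Zp.
apply: val_inj; rewrite /eta val_insubd ltn_pmod ?prime_gt0 //=.
by rewrite val_Fp_nat.
Qed.

(** Each interval contributes an L1 norm of at most 4 p ln p, so dividing the correlation bound by
    p^2 leaves 16 (ln p)^2 B. Stating the condition on [B ^+ 4] keeps fourth roots out of the
    argument. *)
Lemma discT_eta_le p a k m l m' l' (B : R) :
  prime p -> ~~ (p %| a)%N -> (2 <= k <= p - 2)%N -> coprime k (p - 1) ->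
  (l <= p)%N -> (l' <= p)%N ->
  0 <= B -> 2 * k%:R * p%:R ^+ 3 <= B ^+ 4 ->
  discT (interval_set p m' l') (eta p a k @: interval_set p m l) <=
  16 * ln p%:R ^+ 2 * B.
Proof.
move=> p_pr a_p /andP[k_ge2 k_lt] cop le_lp le_lp' B_ge0 leB.
set I := interval_set p m l; set J := interval_set p m' l'.
pose w := unit_root p; have wp1 : w ^+ p = 1 := unit_root_order (prime_gt0 p_pr).
have p_gt2 : (2 < p)%N by lia.
have w_neq1 : w != 1.
  rewrite -subr_eq0 -normr_gt0 -[w]expr1.
  apply: lt_le_trans (@unit_root_gap p 1 _); last by rewrite prime_gt1.
  rewrite ltcR !mulr_gt0 ?invr_gt0 ?addr_gt0 ?invr_gt0 ?ltr0n //; lia.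
pose psi := root_character w : 'F_p -> R[i].
have cardF : #|'F_p| = p by rewrite card_Fp.
have nz_a : a%:R != 0 :> 'F_p.
  by rewrite -val_eqE /= val_Fp_nat // -/(dvdn p a).
have nz_k : k%:R != 0 :> 'F_p.
  by rewrite -val_eqE /= val_Fp_nat // modn_small; lia.
pose h (x : 'F_p) : 'F_p := a%:R * x ^+ k.
have inj_h : injective h.
  move=> x y /(mulfI nz_a); apply: expr_inj_coprime; first by lia.
  by rewrite cardF -subn1.
have leS (u v : 'F_p) : u != 0 -> `|expsum psi h u v| <= B%:C%C.
  move=> nz_u.
  (* The multiplier [a] is absorbed into the second frequency, hence the uniformity in [a]. *)
  have -> : expsum psi h u v = expsum psi (fun x => x ^+ k) u (v * a%:R).
    by apply: eq_bigr => x _; rewrite mulrA.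
  rewrite -(@ler_pXn2r _ 4%N) ?nnegrE ?normr_ge0 ?ler0c //.
  have le4 := @expsum_pow_le 'F_p _ psi k u (v * a%:R) (root_character0 p_pr wp1)
    (root_characterD p_pr wp1) (root_characterJ p_pr wp1)
    (root_character_nontriv p_pr wp1 w_neq1) k_ge2 nz_k nz_u.
  apply: le_trans le4 _; rewrite cardF -(rmorphXn (real_complex R)).
  suff -> : 2 * k%:R * p%:R ^+ 3 = (2 * k%:R * p%:R ^+ 3)%:C%C :> R[i].
    by rewrite lecR.
  by rewrite 2!(rmorphM (real_complex R)) (rmorphXn (real_complex R)) !rmorph_nat.
pose c := cast_ord (Fp_cast p_pr).
pose ind (T : {set 'I_p}) (x : 'F_p) : R[i] := (c x \in T)%:R.
have sum_c (G : 'I_p -> R[i]) : \sum_x G (c x) = \sum_i G i.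
  rewrite [RHS](reindex c) //; exists (cast_ord (esym (Fp_cast p_pr))) => x _.
    exact: cast_ordK.
  exact: cast_ordKV.
have sum_ind T : \sum_x ind T x = #|T|%:R.
  rewrite (sum_c (fun i => (i \in T)%:R)) -sum1_card natr_sum [RHS]big_mkcond.
  by apply: eq_bigr => i _; case: ifP.
have inj_eta : injective (eta p a k).
  move=> i j; rewrite -(cast_ordKV (Fp_cast p_pr) i) -(cast_ordKV (Fp_cast p_pr) j).
  by rewrite !eta_cast => /cast_ord_inj /inj_h ->.
(* Injectivity of [eta] lets points of the image in [J] be counted by their preimages in [I]. *)
have sum_corr : \sum_x ind I x * ind J (h x) = #|eta p a k @: I :&: J|%:R.
  have -> : eta p a k @: I :&: J = eta p a k @: (I :&: eta p a k @^-1: J).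
    apply/setP => y; rewrite inE; apply/andP/imsetP => [[/imsetP[x Ix ->] Jy]|[x]].
      by exists x; rewrite // in_setI Ix inE.
    by rewrite in_setI => /andP[Ix]; rewrite inE => Jx ->; rewrite imset_f.
  rewrite card_imset // -sum1_card natr_sum [RHS]big_mkcond.
  rewrite -(sum_c (fun i => if i \in _ then 1 else 0)); apply: eq_bigr => x _.
  rewrite in_setI [_ \in _ @^-1: _]inE eta_cast /ind /c.
  by do 2!case: (_ \in _); rewrite ?mul1r ?mul0r.
have := discrepancy_le_expsum (root_character0 p_pr wp1)
  (root_characterD p_pr wp1) (root_character_nontriv p_pr wp1 w_neq1)
  (ind I) (ind J) inj_h leS.
rewrite sum_corr !sum_ind cardF.
have leI : \sum_(u : 'F_p | u != 0) `|dft psi (ind I) u| <=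
             (4 * p%:R * ln p%:R)%:C%C.
  exact: sum_dft_interval_le.
have leJ : \sum_(u : 'F_p | u != 0) `|dft psi (ind J) u| <=
             (4 * p%:R * ln p%:R)%:C%C.
  exact: sum_dft_interval_le.
move=> /le_trans /(_ (ler_wpM2r _ (ler_pM _ _ leI leJ))).
rewrite !sumr_ge0 // ler0c => /(_ B_ge0 isT isT).
rewrite /discT card_imset // !INRE RabsE RdivE.
move: (#|_ :&: J|) (#|I|) (#|J|) => N nI nJ.
have nz_p : p%:R != 0 :> R by rewrite pnatr_eq0 -lt0n prime_gt0.
have -> : p%:R ^+ 2 * N%:R - p%:R * nI%:R * nJ%:R =
          (p%:R ^+ 2 * (N%:R - nI%:R * nJ%:R / p%:R))%:C%C :> R[i].
  rewrite -[p%:R in LHS](rmorph_nat (real_complex R)).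
  rewrite -[N%:R in LHS](rmorph_nat (real_complex R)).
  rewrite -[nI%:R in LHS](rmorph_nat (real_complex R)).
  rewrite -[nJ%:R in LHS](rmorph_nat (real_complex R)).
  rewrite -(rmorphXn (real_complex R)) -!(rmorphM (real_complex R)) -rmorphB.
  apply: (congr1 (real_complex R)); rewrite mulrBr; congr (_ - _).
  by rewrite [RHS]mulrC expr2 mulrA divfK // mulrC mulrA.
rewrite normc_def /= expr0n addr0 sqrtr_sqr -!(rmorphM (real_complex R)) lecR.
rewrite normrM ger0_norm ?exprn_ge0 // => le_p2.
have p2_gt0 : 0 < p%:R ^+ 2 :> R by rewrite exprn_gt0 // ltr0n prime_gt0.
rewrite -(ler_pM2l p2_gt0); apply: le_trans le_p2 _.
have -> : 16 = 4 ^+ 2 :> R by rewrite -natrX.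
rewrite -expr2 !exprMn; move: (4 ^+ 2) (p%:R ^+ 2) (ln _ ^+ 2) => x y z.
by rewrite [x * y]mulrC -!mulrA lexx.
Qed.

Local Close Scope ring_scope.
Local Open Scope R_scope.

Theorem mainTheorem8 :
  exists C : R, 0 < C /\
    forall p a k : nat,
      prime p -> ~~ (p %| a)%N -> (2 <= k <= p - 2)%N -> coprime k (p - 1)%N ->
      Dperm (eta p a k) <=
        C * Rpower (INR k) (1 / 4) * Rpower (INR p) (3 / 4) * (ln (INR p)) ^ 2.
Proof.
(* 32 is 16 from [discT_eta_le] times the factor 2 in [B] below; that 2 gives B^4 = 16 k p^3, enough
   for the required 2 k p^3. *)
exists 32; split; first by lra.
move=> p a k p_pr a_p k_bd cop.
have k_gt0 : 0 < INR k by apply: lt_0_INR; lia.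
have p_gt0 : 0 < INR p by apply: lt_0_INR; lia.
pose B := 2 * Rpower (INR k) (1 / 4) * Rpower (INR p) (3 / 4).
have B_gt0 : 0 < B.
  by apply: Rmult_lt_0_compat; [apply: Rmult_lt_0_compat; first lra|]; apply: exp_pos.
have B4 : B ^ 4 = 16 * INR k * INR p ^ 3.
  rewrite !Rpow_mult_distr -!Rpower_pow ?Rpower_mult; try exact: exp_pos; try lra.
  have -> : 1 / 4 * INR 4 = 1 by rewrite /=; lra.
  have -> : 3 / 4 * INR 4 = INR 3 by rewrite /=; lra.
  by rewrite Rpower_1 // Rpower_pow //; lra.
set M := 32 * _ * _ * _; have M_ge0 : 0 <= M.
  rewrite /M.
  have -> : 32 * Rpower (INR k) (1 / 4) * Rpower (INR p) (3 / 4) = 16 * B.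
    by rewrite /B; ring.
  by apply: Rmult_le_pos; [lra | apply: pow2_ge_0].
rewrite /Dperm.
(* The neutral element 0 of the maximum must also satisfy the bound, which is [M_ge0]. *)
apply: (big_ind (fun x => x <= M)) => // [x y|]; first exact: Rmax_lub.
move=> I /existsP[m /existsP[l /eqP ->]].
apply: (big_ind (fun x => x <= M)) => // [x y|]; first exact: Rmax_lub.
move=> J /existsP[m' /existsP[l' /eqP ->]].
have leB : (2 * k%:R * p%:R ^+ 3 <= B ^+ 4)%R.
  apply/RleP; rewrite -RpowE B4 -!INRE -RpowE -!RmultE [INR 2]/=.
  have : 0 < INR k * INR p ^ 3 by apply: Rmult_lt_0_compat; last exact: pow_lt.
  by lra.
have B_ge0 : (0 <= B)%R by apply/RleP/Rlt_le.
have le_l (j : 'I_p.+1) : (j <= p)%N by rewrite -ltnS.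
have /RleP := @discT_eta_le p a k m l m' l' B p_pr a_p k_bd cop
  (le_l l) (le_l l') B_ge0 leB.
move/Rle_trans; apply; rewrite -INRE -!RmultE -RpowE -INRE [INR 16]/=.
by right; rewrite /M /B; ring.
Qed.
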